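(* Let $r\ge 1$ and $k\ge 0$ be integers, and let $G$ be a connected graph of order $n\ge 2(2r+k+2)(r+k+2)$ with minimum degree $\delta(G)\ge r+k$. If $\lambda(G)\ge \lambda(F_n^{r,k})$, then $G$ is a fractional $(r,k)$-critical graph, unless $G\cong F_n^{r,k}$.
   Context: All graphs are finite, simple and undirected. $\lambda(G)$ denotes the spectral radius (largest adjacency eigenvalue) of $G$. A fractional $r$-factor (fractional $[r,r]$-factor) of $G$ exists if there is $h:E(G)\to[0,1]$ with $\sum_{e\ni v}h(e)=r$ for every vertex $v$. $G$ is fractional $(r,k)$-critical if for every set $X$ of $k$ vertices, $G-X$ has a fractional $r$-factor. $K_m$ is the complete graph, $\cup$ disjoint union, $\vee$ join, $(r+1)K_1$ the edgeless graph on $r+1$ vertices. $F_n^{r,k}$ is the graph obtained from $K_{r+k}\vee\big(K_{n-2r-k-1}\cup (r+1)K_1\big)$ by adding $r-1$ edges between one (fixed) vertex of $(r+1)K_1$ and $r-1$ vertices of $K_{n-2r-k-1}$. *)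

(* Defs.v *)
(* MathComp / MathComp-Analysis *)
From HB Require Import structures.
From mathcomp Require Import all_boot all_order all_algebra.
From mathcomp Require Import classical_sets reals.

Set Implicit Arguments.
Unset Strict Implicit.
Unset Printing Implicit Defensive.

Import Order.TTheory GRing.Theory Num.Theory.

Record sgraph := SGraph {
  vertex :> finType;
  adj : rel vertex;
  adj_sym : symmetric adj;
  adj_irrefl : irreflexive adj }.

Arguments adj {s} x y.

Definition edges (G : sgraph) : {set {set G}} :=
  [set [set p.1; p.2] | p : G * G & adj p.1 p.2].

Definition degree (G : sgraph) (x : G) : nat := #|[set y | adj x y]|.

(* Every degree is smaller than #|G|, so the default value #|G| is only
   reached when G has no vertex. *)
Definition min_degree (G : sgraph) : nat := \big[minn/#|G|]_(x : G) degree x.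

Definition connected (G : sgraph) : Prop := forall x y : G, connect adj x y.

Definition isomorphic (G H : sgraph) : Prop :=
  exists f : G -> H, bijective f /\ forall x y, adj (f x) (f y) = adj x y.

Section Constructions.

Lemma complete_sym n : symmetric (fun i j : 'I_n => i != j).
Proof. by move=> i j; rewrite eq_sym. Qed.

Lemma complete_irrefl n : irreflexive (fun i j : 'I_n => i != j).
Proof. by move=> i; rewrite eqxx. Qed.

Definition complete n : sgraph := SGraph (@complete_sym n) (@complete_irrefl n).

Definition edgeless n : sgraph :=
  @SGraph 'I_n (fun _ _ => false) (fun _ _ => erefl) (fun _ => erefl).

(* [b] tells whether the vertices of G are adjacent to those of H. *)
Definition sum_adj (b : bool) (G H : sgraph) (u v : G + H) : bool :=
  match u, v with
  | inl x, inl y => adj x y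
  | inr x, inr y => adj x y
  | _, _ => b
  end.

Lemma sum_adj_sym b G H : symmetric (@sum_adj b G H).
Proof. by move=> [x|x] [y|y] //=; rewrite adj_sym. Qed.

Lemma sum_adj_irrefl b G H : irreflexive (@sum_adj b G H).
Proof. by move=> [x|x] /=; rewrite adj_irrefl. Qed.

Definition disjoint_union (G H : sgraph) : sgraph :=
  SGraph (@sum_adj_sym false G H) (@sum_adj_irrefl false G H).

Definition join (G H : sgraph) : sgraph :=
  SGraph (@sum_adj_sym true G H) (@sum_adj_irrefl true G H).

Definition add_edges_adj (G : sgraph) (e : rel G) (x y : G) : bool :=
  adj x y || (x != y) && (e x y || e y x).

Lemma add_edges_sym G e : symmetric (@add_edges_adj G e).
Proof.
by move=> x y; rewrite /add_edges_adj adj_sym eq_sym [e y x || _]orbC.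
Qed.

Lemma add_edges_irrefl G e : irreflexive (@add_edges_adj G e).
Proof. by move=> x; rewrite /add_edges_adj adj_irrefl eqxx. Qed.

Definition add_edges (G : sgraph) (e : rel G) : sgraph :=
  SGraph (@add_edges_sym G e) (@add_edges_irrefl G e).

Variables (G : sgraph) (X : {set G}).

Definition delete_adj : rel {x : G | x \notin X} := relpre val adj.

Lemma delete_sym : symmetric delete_adj.
Proof. by move=> x y; rewrite /delete_adj /= adj_sym. Qed.

Lemma delete_irrefl : irreflexive delete_adj.
Proof. by move=> x; rewrite /delete_adj /= adj_irrefl. Qed.

Definition delete_vertices : sgraph := SGraph delete_sym delete_irrefl.

End Constructions.

(* The graph F_n^{r,k}. The fixed vertex of (r+1)K_1 is number 0, and its
   r-1 new neighbours in K_{n-2r-k-1} are the vertices numbered 0, ..., r-2.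
   Subtractions are truncated: the definition is meaningful for 1 <= r and
   3 * r + k <= n. *)
Definition Fbase (n r k : nat) : sgraph :=
  join (complete (r + k))
       (disjoint_union (complete (n - (2 * r + k + 1))) (edgeless r.+1)).

Definition Fnew (n r k : nat) : rel (Fbase n r k) :=
  fun u v => match u, v with
  | inr (inr i), inr (inl j) => (val i == 0) && (val j < r - 1)
  | _, _ => false
  end.

Definition Fgraph (n r k : nat) : sgraph := add_edges (@Fnew n r k).

Local Open Scope ring_scope.

Definition adjacency (R : realType) (G : sgraph) : 'M[R]_#|G| :=
  \matrix_(i, j) (adj (enum_val i) (enum_val j))%:R.

(* The largest eigenvalue: for a graph with at least one vertex the set below
   is finite and, the adjacency matrix being real symmetric, nonempty, so that
   the supremum is a maximum. *)
Definition spectral_radius (R : realType) (G : sgraph) : R :=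
  sup [set a : R | eigenvalue (adjacency R G) a]%classic.

(* The values of h outside [edges G] are irrelevant. *)
Definition has_fractional_factor (R : realType) (r : nat) (G : sgraph) : Prop :=
  exists h : {set G} -> R,
    (forall e, e \in edges G -> 0 <= h e <= 1) /\
    (forall v : G, \sum_(e in edges G | v \in e) h e = r%:R).

Definition fractional_critical (R : realType) (r k : nat) (G : sgraph) : Prop :=
  forall X : {set G}, #|X| = k ->
    has_fractional_factor R r (delete_vertices X).

(* Main.v *)
(** Proof idea.  If [G] is not fractional [(r,k)]-critical, minimising the
    squared defect [sum_v (r - d_h(v))^2] over all weights [h] on the edges of
    [G - X] yields disjoint sets [S], [T] with [|S| = k + j] and
    [sum_(v in T) d_(G-S)(v) + r j < r |T|]; the minimum degree then forces
    [|T| >= r + 1].  Let [z > 0] be the Perron vector of [G] and [a] its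
    spectral radius; since [F] contains a clique on [n - r - 1] vertices,
    [a >= n - r - 2].

    If [|T| >= r + 2], then [G] has too few edges for Hong's bound
    [a^2 <= 2 m - n + 1].

    If [|T| = r + 1], both graphs are a core on [c = n - r - 1] vertices
    together with [r + 1] vertices of small degree, and to leading order
    [a (a + 1) (a + 1 - c)] is the sum of the squares of these small degrees.
    The lower bound for [F] comes from a test vector, the upper bound for [G]
    from [z].  The total small degree of [G] is at most that of [F], and [F]
    concentrates the excess at one vertex, so its sum of squares exceeds that
    of [G] by more than the error term, unless [G] is a spanning subgraph of
    [F]; in that case the Rayleigh quotient of [z] gives [G = F]. *)

From Pilot Require Import Defs.
From mathcomp Require Import all_boot all_order all_algebra reals.
From mathcomp Require Import boolp classical_sets topology normedtype derive.
From mathcomp Require Import zify ring lra.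

Import Order.TTheory GRing.Theory Num.Theory.
Import numFieldNormedType.Exports.
(* [topology] also defines a predicate named [connected]. *)
Import Pilot.Defs.

(** * Spectral radius and Perron vector *)

Section Compactness.
Local Open Scope ring_scope.
Local Open Scope classical_set_scope.
Context {R : realType} {I : finType}.

Notation V := 'rV[R]_#|I|.
(** Reads a row vector as a function on [I], so that compactness of boxes of row vectors applies to
    vertex and edge weightings. *)
Definition coord (v : V) (i : I) : R := v ord0 (enum_rank i).

Lemma continuous_bigsum (J : Type) (s : seq J) (F : J -> V -> R) :
  (forall j, continuous (F j)) -> continuous (fun v => \sum_(j <- s) F j v).
Proof.
move=> cF; elim: s => [|j s IHs] v.
  have -> : (fun v => \sum_(j <- [::]) F j v) = (fun=> 0 : R).
    by apply: funext => w; rewrite big_nil.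
  exact: cst_continuous.
have -> : (fun v => \sum_(j <- j :: s) F j v) =
          (fun v => F j v + \sum_(j <- s) F j v).
  by apply: funext => w; rewrite big_cons.
by apply: continuousD; [exact: cF | exact: IHs].
Qed.

Lemma continuous_coord i : continuous (fun v : V => coord v i).
Proof. exact: coord_continuous. Qed.

(** Extreme value theorem in the form used twice below: for the Rayleigh quotient on the unit sphere
    and for the squared defect of an edge weighting. *)
Lemma box_closed_min (K : set (I -> R)) (f : (I -> R) -> R) (a b : R) :
  (exists2 x, K x & forall i, a <= x i <= b) ->
  closed [set v : V | K (coord v)] ->
  continuous (fun v : V => f (coord v)) ->
  exists x, [/\ K x, forall i, a <= x i <= b &
    forall y, K y -> (forall i, a <= y i <= b) -> f x <= f y].
Proof.
move=> [x0 Kx0 x0b] cK cf.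
pose B := [set v : V | forall j, `[a, b] (v ord0 j)].
have compactB : compact B by exact: (rV_compact (fun=> @segment_compact _ _ _)).
have coordK x : coord (\row_j x (enum_val j)) = x.
  by apply: funext => i; rewrite /coord mxE enum_rankK.
have inB x : (forall i, a <= x i <= b) -> B (\row_j x (enum_val j)).
  by move=> xb j; rewrite /= mxE in_itv xb.
have [|||v] := EVT_min_rV _ (A := B `&` [set v | K (coord v)])
    (f := fun v => f (coord v)).
- by exists (\row_j x0 (enum_val j)); split; [exact: inB | rewrite /= coordK].
- exact: compact_closedI.
- exact: continuous_subspaceT.
rewrite inE => -[vB vK] min; exists (coord v); split => //.
  by move=> i; have := vB (enum_rank i); rewrite /= in_itv.
move=> y Ky yb; rewrite -[y]coordK; apply: min; rewrite inE.
by split; [exact: inB | rewrite /= coordK].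
Qed.

End Compactness.

Section Rayleigh.
Local Open Scope ring_scope.
Context {R : realType} {G : sgraph}.
Implicit Types (x y : G -> R) (u v : G).

(** The adjacency operator, acting on vertex functions rather than on vectors indexed by an
    enumeration. *)
Definition nbsum x u : R := \sum_(v | adj u v) x v.
Definition dot x y : R := \sum_u x u * y u.

Lemma nbsum_adjoint x y : dot x (nbsum y) = dot (nbsum x) y.
Proof.
rewrite /dot /nbsum; under eq_bigr => u _ do rewrite mulr_sumr.
under [RHS]eq_bigr => u _ do rewrite mulr_suml.
rewrite [RHS](exchange_big_dep predT) //=; apply: eq_bigr => u _.
by apply: eq_bigl => v; rewrite adj_sym.
Qed.

Lemma nbsumD x y c u : nbsum (fun v => x v + c * y v) u = nbsum x u + c * nbsum y u.
Proof. by rewrite /nbsum big_split -mulr_sumr. Qed.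

Lemma dotC x y : dot x y = dot y x.
Proof. by apply: eq_bigr => u _; rewrite mulrC. Qed.

Lemma dotDr x y z c : dot x (fun v => y v + c * z v) = dot x y + c * dot x z.
Proof.
by rewrite /dot mulr_sumr -big_split; apply: eq_bigr => u _ /=; ring.
Qed.

Lemma dotDl x y z c : dot (fun v => y v + c * z v) x = dot y x + c * dot z x.
Proof. by rewrite dotC dotDr !(dotC x). Qed.

Lemma dot_ge0 x : 0 <= dot x x.
Proof. by apply: sumr_ge0 => u _; rewrite -expr2 sqr_ge0. Qed.

Lemma dot_eq0 x : dot x x = 0 -> forall u, x u = 0.
Proof.
move=> /eqP; rewrite psumr_eq0 => [/allP x0 u|u _]; last by rewrite -expr2 sqr_ge0.
by have /(_ u) := x0; rewrite mem_index_enum mulf_eq0 orbb => /(_ isT)/eqP.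
Qed.

Definition is_eigenfunction (a : R) x := forall u, nbsum x u = a * x u.

Lemma eigenvalueP_fun (a : R) :
  reflect (exists2 x, is_eigenfunction a x & exists u, x u != 0)
          (eigenvalue (adjacency R G) a).
Proof.
have key (w : 'rV[R]_#|G|) (x : G -> R) j : (forall u, x u = w ord0 (enum_rank u)) ->
    (w *m adjacency R G) ord0 j = nbsum x (enum_val j).
  move=> xw; rewrite mxE /nbsum (reindex (@enum_rank G)) /=; last first.
    by apply: onW_bij; exact: enum_rank_bij.
  rewrite [RHS]big_mkcond /=; apply: eq_bigr => v _.
  rewrite mxE xw enum_rankK adj_sym.
  by case: ifP => _; rewrite ?mulr1 ?mulr0.
apply: (iffP eigenvalueP) => [[w wA w0]|[x xA [u xu]]].
  exists (fun u => w ord0 (enum_rank u)) => [u|].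
    by rewrite -{1}[u]enum_rankK -(key w) // wA mxE.
  apply/existsP; apply: contraNT w0; rewrite negb_exists => /forallP w0.
  apply/eqP/rowP => j; rewrite mxE; apply/eqP.
  by have := w0 (enum_val j); rewrite negbK enum_valK.
exists (\row_j x (enum_val j)).
  apply/rowP => j; rewrite (key _ x) => [|v]; last by rewrite mxE enum_rankK.
  by rewrite xA !mxE.
apply: contraNneq xu => /rowP/(_ (enum_rank u)).
by rewrite !mxE enum_rankK => ->.
Qed.

(* At a maximiser x of the Rayleigh quotient, with value m, moving along the
   residue w = A x - m x changes the quotient at first order by 2 |w|^2. *)
Lemma rayleigh_max_eigen (m : R) x :
  dot x (nbsum x) = m * dot x x ->
  (forall y, dot y (nbsum y) <= m * dot y y) -> is_eigenfunction m x.
Proof.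
move=> xm maxm; pose w u := nbsum x u - m * x u.
suff /dot_eq0 w0 : dot w w = 0.
  by move=> u; apply/eqP; rewrite -subr_eq0; apply/eqP/w0.
have wE : dot w w = dot w (nbsum x) - m * dot w x.
  rewrite -mulNr -dotDr; apply: eq_bigr => u _.
  by rewrite {2}/w mulNr.
pose C := dot w (nbsum w) - m * dot w w.
have step e : 2 * e * dot w w + e ^+ 2 * C <= 0.
  have := maxm (fun u => x u + e * w u).
  have -> : nbsum (fun u => x u + e * w u) = fun u => nbsum x u + e * nbsum w u.
    by apply: funext => u; rewrite nbsumD.
  rewrite !dotDl !dotDr [dot x (nbsum w)]nbsum_adjoint (dotC (nbsum x)) (dotC x w).
  move: wE xm; rewrite /C; set W := dot w w; set a := dot w (nbsum x).
  set b := dot w x; set c := dot x _; set d := dot x x => -> ->.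
  set f := dot w (nbsum w); nra.
have W0 := dot_ge0 w; apply/eqP; rewrite eq_le W0 andbT leNgt.
apply/negP => Wp.
have Cp : 0 < 1 + `|C| by rewrite ltr_pwDl.
(* This [e] satisfies [e * |C| < dot w w], so the first-order term beats [e ^+ 2 * C]. *)
have := step (dot w w / (1 + `|C|)); set e := _ / _.
have e0 : 0 < e by rewrite divr_gt0.
have eC : e * (1 + `|C|) = dot w w by rewrite /e divfK // gt_eqF.
have := ler_normr C; have := ler_norm (- C); rewrite normrN => nC _.
apply/negP; rewrite -ltNge.
nra.
Qed.


Lemma dotZ c x : dot (fun u => c * x u) (fun u => c * x u) = c ^+ 2 * dot x x.
Proof. by rewrite /dot mulr_sumr; apply: eq_bigr => u _; ring. Qed.

Lemma nbsumZ c x : nbsum (fun u => c * x u) = (fun u => c * nbsum x u).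
Proof. by apply: funext => u; rewrite /nbsum mulr_sumr. Qed.

Lemma dot_nbsumZ c x :
  dot (fun u => c * x u) (nbsum (fun u => c * x u)) = c ^+ 2 * dot x (nbsum x).
Proof. by rewrite nbsumZ /dot mulr_sumr; apply: eq_bigr => u _; ring. Qed.

Lemma rayleigh_max_exists (u0 : G) : exists2 x, dot x x = 1 &
  forall y, dot y (nbsum y) <= dot x (nbsum x) * dot y y.
Proof.
pose cd (w : 'rV[R]_#|G|) : G -> R := coord w.
have c_nb u : continuous (fun w => nbsum (cd w) u).
  move=> v; rewrite /nbsum /=.
  have -> : (fun w => \sum_(j | adj u j) cd w j) =
            (fun w => \sum_(j <- [seq j <- index_enum G | adj u j]) cd w j).
    by apply: funext => w; rewrite big_filter.
  by apply: continuous_bigsum => j; exact: continuous_coord.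
have c_dot : continuous (fun w => dot (cd w) (cd w)).
  apply: continuous_bigsum => u v.
  by apply: continuousM; exact: continuous_coord.
have c_q : continuous (fun w => dot (cd w) (nbsum (cd w))).
  apply: continuous_bigsum => u v.
  by apply: continuousM; [exact: continuous_coord | exact: c_nb].
(* Puts the unit sphere inside the box [[-1, 1]] on which the minimum is taken. *)
have bound x : dot x x = 1 -> forall u, -1 <= x u <= 1.
  move=> x1 u; rewrite -ler_norml -[leLHS]ger0_norm // -(@ler_pXn2r _ 2) ?nnegrE //.
  rewrite normr_id real_normK ?num_real // expr1n -x1 /dot (bigD1 u) //= -expr2 lerDl.
  by apply: sumr_ge0 => v _; rewrite -expr2 sqr_ge0.
have [|||x [x1 _ min]] := @box_closed_min R G [set x | dot x x = 1]%classic
    (fun x => - dot x (nbsum x)) (-1) 1.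
- have e1 : dot (fun u => (u == u0)%:R) (fun u => (u == u0)%:R) = 1.
    rewrite /dot (bigD1 u0) //= eqxx mulr1.
    by rewrite big1 ?addr0 // => u /negbTE ->; rewrite mulr0.
  by exists (fun u => (u == u0)%:R) => //; exact: bound.
- exact: (proj1 (continuous_closedP _) c_dot _ (@closed_eq R 1)).
- by move=> v; exact: (continuousN (c_q v)).
exists x => // y; have [y0|y0] := eqVneq (dot y y) 0.
  have s0 w : dot y w = 0.
    by rewrite /dot big1 // => u _; rewrite (dot_eq0 _ y0) mul0r.
  by rewrite !s0 mulr0.
have yp : 0 < dot y y by rewrite lt_neqAle dot_ge0 andbT eq_sym.
pose c := (Num.sqrt (dot y y))^-1.
have c2 : c ^+ 2 = (dot y y)^-1 by rewrite exprVn sqr_sqrtr // ltW.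
have cy1 : dot (fun u => c * y u) (fun u => c * y u) = 1.
  by rewrite dotZ c2 mulVf ?gt_eqF.
have := min (fun u => c * y u) cy1 (bound _ cy1).
by rewrite dot_nbsumZ c2 lerN2 mulrC ler_pdivrMr.
Qed.

(** The maximal Rayleigh quotient is an eigenvalue, and each eigenvalue is the quotient of its
    eigenfunction, so the supremum is this maximum. *)
Lemma spectral_radiusP (u0 : G) : exists x,
  [/\ dot x x = 1, is_eigenfunction (spectral_radius R G) x &
      forall y, dot y (nbsum y) <= spectral_radius R G * dot y y].
Proof.
have [x x1 max] := rayleigh_max_exists u0; set m := dot x _ in max.
have xm : is_eigenfunction m x by apply: rayleigh_max_eigen => //; rewrite x1 mulr1.
suff -> : spectral_radius R G = m by exists x.
have mE : eigenvalue (adjacency R G) m.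
  apply/eigenvalueP_fun; exists x => //.
  apply/existsP; apply: contraT; rewrite negb_exists => /forallP x0.
  have /eqP : dot x x = 0 by rewrite /dot big1 // => u _; move: (x0 u); rewrite negbK => /eqP ->; rewrite mul0r.
  by rewrite x1 oner_eq0.
have ubm : ubound [set a : R | eigenvalue (adjacency R G) a]%classic m.
  move=> a /= /eigenvalueP_fun[y ya [u yu]].
  have yp : 0 < dot y y.
    rewrite lt_neqAle dot_ge0 andbT eq_sym; apply: contra_neq yu.
    by move=> /dot_eq0.
  have := max y; have -> : dot y (nbsum y) = a * dot y y.
    by rewrite /dot mulr_sumr; apply: eq_bigr => v _; rewrite ya; ring.
  by rewrite ler_pM2r.
apply/eqP; rewrite eq_le /spectral_radius; apply/andP; split.
  by apply: ge_sup => //; exists m.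
by apply: ub_le_sup => //; exists m.
Qed.

(** Taking absolute values cannot lower the Rayleigh quotient, so [|x|] is an eigenfunction too. A
    zero of it would spread to all neighbours, hence by connectedness to the whole graph. *)
Lemma perron (u0 : G) : connected G -> exists2 z : G -> R,
  (forall u, 0 < z u) & is_eigenfunction (spectral_radius R G) z.
Proof.
move=> cG; have [x [x1 xE max]] := spectral_radiusP u0.
pose z u := `|x u|.
have z0 u : 0 <= z u by exact: normr_ge0.
have zz : dot z z = 1.
  by rewrite -x1; apply: eq_bigr => u _; rewrite /z -expr2 -normrX ger0_norm ?sqr_ge0 ?expr2.
have zE : is_eigenfunction (spectral_radius R G) z.
  apply: rayleigh_max_eigen => //; apply/eqP; rewrite eq_le max zz -x1 /=.
  rewrite /dot mulr_sumr; apply: ler_sum => u _; rewrite mulrCA -xE.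
  apply: (le_trans (ler_norm _)); rewrite normrM ler_wpM2l //.
  exact: ler_norm_sum.
exists z => // u; rewrite lt_neqAle z0 andbT eq_sym; apply/eqP => zu.
have zero v : connect adj u v -> z v = 0.
  move=> /connectP[p]; elim: p u zu => [|w p IHp] u zu /=; first by move=> _ ->.
  case/andP=> uw; apply: IHp; move: (zE u); rewrite zu mulr0 => /eqP.
  by rewrite psumr_eq0 // => /allP/(_ w); rewrite mem_index_enum uw => /(_ isT)/eqP.
by move: zz; rewrite /dot big1 => [/eqP|v _]; [rewrite eq_sym oner_eq0 | rewrite zero ?mul0r].
Qed.

End Rayleigh.

(** * Obstruction to fractional factors *)

Section FractionalFactor.
Local Open Scope ring_scope.
Context {R : realType} (r : nat) (H : sgraph).
Implicit Types (h : {set H} -> R) (u v w : H).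

Definition fdeg h v : R := \sum_(e in edges H | v \in e) h e.

Lemma edgesP e : reflect (exists2 p : H * H, adj p.1 p.2 & e = [set p.1; p.2])
  (e \in edges H).
Proof.
apply: (iffP imsetP) => -[p]; first by rewrite inE => pa ->; exists p.
by move=> pa ->; exists p => //; rewrite inE.
Qed.

Lemma set2_inj v : {in adj v &, injective (fun w => [set v; w])}.
Proof.
move=> w w' vw vw' /setP/(_ w); rewrite !inE eqxx orbT => /esym/orP[]/eqP // wv.
by have : adj v w := vw; rewrite wv adj_irrefl.
Qed.

Lemma fdegE h v : fdeg h v = \sum_(w | adj v w) h [set v; w].
Proof.
rewrite /fdeg -(big_imset h (@set2_inj v)) /=; apply: eq_bigl => e.
apply/andP/imsetP => [[/edgesP[[a b] /= ab ->]]|[w vw ->]].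
  rewrite !inE => /orP[]/eqP ->; first by exists b.
  by exists a; [rewrite -topredE /= adj_sym | rewrite finset.setUC].
by split; [apply/edgesP; exists (v, w) | rewrite !inE eqxx].
Qed.

Definition defect h v : R := r%:R - fdeg h v.

(* Changing [h] by [t] at the edge [uw] changes the sum of the squared defects
   by [2 t^2 - 2 t (defect u + defect w)]. *)
Lemma min_defect_edge h u w t : adj u w ->
  (forall h', (forall e, 0 <= h' e <= 1) ->
     \sum_v defect h v ^+ 2 <= \sum_v defect h' v ^+ 2) ->
  (forall e, 0 <= h e <= 1) -> 0 <= h [set u; w] + t <= 1 ->
  t * (defect h u + defect h w) <= t ^+ 2.
Proof.
move=> uw min hb tb; pose e0 := [set u; w].
pose h' e := h e + (e == e0)%:R * t.
have e0E : e0 \in edges H by apply/edgesP; exists (u, w).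
have h'b e : 0 <= h' e <= 1.
  by rewrite /h'; have [->|_] := eqVneq e e0; rewrite ?mul1r // mul0r addr0.
have h'E v : defect h' v = defect h v - (v \in e0)%:R * t.
  rewrite /defect /fdeg /h' big_split /= opprD addrA; congr (_ - _).
  have [ve|ve] := boolP (v \in e0).
    rewrite (bigD1 e0) ?e0E //= eqxx big1 ?addr0 // => e /andP[_ /negbTE ->].
    by rewrite mul0r.
  rewrite mul0r big1 // => e /andP[_ ve']; have [ee|_] := eqVneq e e0.
    by rewrite -ee ve' in ve.
  by rewrite mul0r.
have := min h' h'b; under [leRHS]eq_bigr => v _ do rewrite h'E.
have uNw : u != w by apply: contraTneq uw => ->; rewrite adj_irrefl.
have wNu : w != u by rewrite eq_sym.
rewrite (bigD1 u) // [leRHS](bigD1 u) //= (bigD1 w) // [in leRHS](bigD1 w) //=.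
rewrite !inE !eqxx orbT /= !mul1r.
have -> : \sum_(i | (i != u) && (i != w)) (defect h i - (i \in e0)%:R * t) ^+ 2 =
          \sum_(i | (i != u) && (i != w)) defect h i ^+ 2.
  apply: eq_bigr => i /andP[/negbTE iu /negbTE iw].
  by rewrite !inE iu iw mul0r subr0.
set s := \sum_(i | _) _; nra.
Qed.

Lemma min_defect_exists : exists2 h, forall e, 0 <= h e <= 1 &
  forall h', (forall e, 0 <= h' e <= 1) ->
     \sum_v defect h v ^+ 2 <= \sum_v defect h' v ^+ 2.
Proof.
have c_defect v : continuous
    (fun x : 'rV[R]_#|{set H}| => defect (coord x) v).
  have c_fdeg : continuous (fun x : 'rV[R]_#|{set H}| => fdeg (coord x) v).
    move=> x; rewrite /fdeg /=.
    have -> : (fun y : 'rV[R]_#|{set H}| => \sum_(e in edges H | v \in e) coord y e) =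
      (fun y => \sum_(e <- [seq e <- index_enum {set H} | (e \in edges H) && (v \in e)]) coord y e).
      by apply: funext => w; rewrite big_filter.
    by apply: continuous_bigsum => j; exact: continuous_coord.
  by move=> x; exact: (continuousB (@cst_continuous _ _ (r%:R : R) x) (c_fdeg x)).
have c_sum : continuous
    (fun x : 'rV[R]_#|{set H}| => \sum_v defect (coord x) v * defect (coord x) v).
  by apply: continuous_bigsum => v x; exact: (continuousM (c_defect v x) (c_defect v x)).
have [|||h [_ hb min]] := @box_closed_min R {set H} setT
    (fun h => \sum_v defect h v * defect h v) 0 1.
- by exists (fun=> 0) => // e; rewrite lexx ler01.
- exact: closedT.
- exact: c_sum.
exists h => // h' h'b; under eq_bigr => v _ do rewrite expr2.
under [leRHS]eq_bigr => v _ do rewrite expr2.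
exact: min.
Qed.

(** At a minimiser of the squared defect let [T] and [S] carry the positive and negative defects.
    Edges from [T] to outside [S] must have weight 1 and edges from [S] to outside [T] weight 0.
    Summing weighted degrees over [T] then gives the inequality. *)
Lemma fractional_factor_obstruction : ~ has_fractional_factor R r H ->
  exists S T : {set H}, [disjoint S & T] /\
  (\sum_(v in T) #|[set w | adj v w & w \notin S]| + r * #|S| < r * #|T|)%N.
Proof.
move=> noh; have [h hb min] := min_defect_exists.
pose g := defect h; pose T := [set v | 0 < g v]; pose S := [set v | g v < 0].
exists S, T; split.
  by apply/pred0P => v; rewrite /= !inE; apply/negbTE; rewrite negb_and -!leNgt le_total.
have h1 v w : v \in T -> adj v w -> w \notin S -> h [set v; w] = 1.
  rewrite !inE -leNgt => gv vw gw; apply/eqP; rewrite eq_le.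
  have /andP[h0 ->] /= := hb [set v; w]; rewrite leNgt; apply/negP => hlt.
  (* The first bound keeps the weight at most 1. The second makes [t < G], against [t * G <= t ^+ 2]
     from minimality. *)
  pose G := g v + g w; pose t := Num.min (1 - h [set v; w]) (G / 2).
  have t0 : 0 < t by rewrite lt_min /G; apply/andP; split; lra.
  have [t1 t2] : t <= 1 - h [set v; w] /\ t <= G / 2.
    by rewrite !ge_min !lexx orbT.
  have := @min_defect_edge h v w t vw min hb; rewrite -/(g v) -/(g w) -/G.
  have -> : 0 <= h [set v; w] + t <= 1 by apply/andP; split; lra.
  move=> /(_ isT); rewrite expr2 ler_pM2l //; lra.
have h0 v w : v \in S -> adj v w -> w \notin T -> h [set v; w] = 0.
  rewrite !inE -leNgt => gv vw gw; apply/eqP; rewrite eq_le.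
  have /andP[-> h1'] := hb [set v; w]; rewrite andbT leNgt; apply/negP => hlt.
  pose G := - (g v + g w); pose t := Num.min (h [set v; w]) (G / 2).
  have t0 : 0 < t by rewrite lt_min /G; apply/andP; split; lra.
  have [t1 t2] : t <= h [set v; w] /\ t <= G / 2.
    by rewrite !ge_min !lexx orbT.
  have := @min_defect_edge h v w (- t) vw min hb; rewrite -/(g v) -/(g w).
  have -> : 0 <= h [set v; w] - t <= 1 by apply/andP; split; lra.
  move=> /(_ isT); rewrite sqrrN mulNr -mulrN -/G expr2 ler_pM2l //; lra.
have TE : \sum_(v in T) fdeg h v =
    (\sum_(v in T) #|[set w | adj v w & w \notin S]|)%:R + \sum_(v in S) fdeg h v.
  have -> : \sum_(v in S) fdeg h v =
      \sum_(v in T) \sum_(w | adj v w && (w \in S)) h [set v; w].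
    rewrite (exchange_big_dep (mem S)) /=; last by move=> v w _ /andP[].
    apply: eq_bigr => v vS; rewrite fdegE (bigID (mem T)) /= addrC big1 ?add0r.
      apply: eq_big => [w|w _]; last by rewrite finset.setUC.
      by rewrite vS andbT andbC adj_sym.
    by move=> w /andP[vw wT]; exact: h0.
  rewrite natr_sum -big_split /=; apply: eq_bigr => v vT.
  rewrite fdegE (bigID (mem S)) /= addrC; congr (_ + _).
  rewrite -sum1_card natr_sum; apply: eq_big => [w|w /andP[vw wS]].
    by rewrite inE.
  by rewrite (h1 v w).
have gE v : fdeg h v = r%:R - g v by rewrite /g /defect subKr.
have sumE (A : {set H}) : \sum_(v in A) fdeg h v = r%:R * #|A|%:R - \sum_(v in A) g v.
  under eq_bigr => v _ do rewrite gE.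
  by rewrite sumrB sumr_const mulr_natr.
have gT v : v \in T -> 0 <= g v by rewrite inE => /ltW.
have gS v : v \in S -> 0 <= - g v by rewrite inE oppr_ge0 => /ltW.
have T0 : 0 <= \sum_(v in T) g v by exact: sumr_ge0.
have S0 : 0 <= \sum_(v in S) - g v by exact: sumr_ge0.
(* Strictness: if every defect vanished, [h] would be a fractional factor. *)
have pos : 0 < \sum_(v in T) g v + \sum_(v in S) - g v.
  rewrite lt_neqAle addr_ge0 // andbT eq_sym paddr_eq0 //; apply/negP => /andP[].
  rewrite !psumr_eq0 // => /allP T1 /allP S1; apply: noh; exists h; split => [e _|v].
    exact: hb.
  rewrite -/(fdeg h v) gE; suff -> : g v = 0 by rewrite subr0.
  have := T1 v; have := S1 v; rewrite mem_index_enum !inE oppr_eq0.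
  by case: (ltrgtP (g v) 0) => //= _ /(_ isT)/eqP // _ /(_ isT)/eqP.
rewrite -(ltr_nat R) natrD !natrM.
move: TE; rewrite !sumE; move: pos; rewrite sumrN; lra.
Qed.

End FractionalFactor.

(** The deleted [k]-set is merged with the obstruction set of the remaining graph, whose size is
    [j]. *)
Lemma critical_obstruction (R : realType) (r k : nat) (G : sgraph) :
  ~ fractional_critical R r k G ->
  exists S T : {set G}, exists j : nat, [/\ [disjoint S & T], #|S| = k + j &
    \sum_(v in T) #|[set w | adj v w & w \notin S]| + r * j < r * #|T|].
Proof.
move=> /existsNP[X] /not_implyP[Xk] /fractional_factor_obstruction[S [T [dST lt]]].
have vI := @val_inj _ _ {x : G | x \notin X}.
exists (X :|: val @: S), (val @: T), #|S|; split.
- rewrite -setI_eq0; apply/eqP/setP => x; rewrite !inE; apply/negbTE/negP.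
  move=> /andP[/orP[xX|/imsetP[y yS ->]] /imsetP[y' yT]].
    by move=> xy; move: (valP y'); rewrite -xy xX.
  by move=> /vI yy; move/pred0P/(_ y): dST; rewrite /= yS yy yT.
- rewrite cardsU (card_imset _ vI) Xk.
  suff -> : X :&: val @: S = finset.set0 by rewrite cards0 subn0.
  apply/setP => x; rewrite !inE; apply/negbTE/negP => /andP[xX /imsetP[y _ xy]].
  by move: (valP y); rewrite -xy xX.
rewrite (card_imset _ vI) big_imset /=; last by move=> x y _ _ /vI.
apply: leq_ltn_trans lt; rewrite leq_add2r; apply: leq_sum => v vT.
rewrite -(card_imset _ vI); apply/subset_leq_card/fintype.subsetP => w.
rewrite !inE negb_or => /and3P[vw wX wS]; apply/imsetP; exists (exist _ w wX) => //.
rewrite inE; apply/andP; split; first exact: vw.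
by apply: contra wS => wS; apply/imsetP; exists (exist _ w wX).
Qed.

(** * Spectral bounds *)

Section SpectralBounds.
Local Open Scope ring_scope.
Context {R : realType} {G : sgraph}.
Implicit Types (C T : {set G}) (u v w : G).

Definition deg_in C v : nat := #|[set w in C | adj v w]|.

Lemma deg_in_sum C v : (deg_in C v)%:R = \sum_(w in C | adj v w) (1 : R).
Proof.
rewrite /deg_in -sum1_card natr_sum; apply: eq_bigl => w; by rewrite inE.
Qed.

Lemma deg_inE C v : (deg_in C v + deg_in (~: C) v)%N = degree v.
Proof.
rewrite /deg_in /degree -[RHS](cardsID C); congr (_ + _)%N; apply: eq_card => w;
by rewrite !inE andbC.
Qed.

Lemma sum_deg_in (A B : {set G}) (f : G -> R) :
  \sum_(u in A) \sum_(v in B | adj u v) f v =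
  \sum_(v in B) (deg_in A v)%:R * f v.
Proof.
rewrite (exchange_big_dep (mem B)) /=; last by move=> u v _ /andP[].
apply: eq_bigr => v vB; rewrite deg_in_sum mulr_suml.
by apply: eq_big => [u|u _]; rewrite ?mul1r // vB adj_sym.
Qed.

Lemma nbsum_split C (x : G -> R) u : nbsum x u =
  \sum_(v in C | adj u v) x v + \sum_(v in ~: C | adj u v) x v.
Proof.
rewrite /nbsum (bigID (mem C)) /=; congr (_ + _); apply: eq_bigl => v;
by rewrite ?inE andbC.
Qed.

Definition is_clique C := {in C &, forall u v, u != v -> adj u v}.

Lemma sum_clique_nb C (x : G -> R) u : is_clique C -> u \in C ->
  \sum_(v in C | adj u v) x v = \sum_(v in C) x v - x u.
Proof.
move=> clC uC; rewrite (bigD1 u uC) /= addrC addrK; apply: eq_bigl => v.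
change ((v \in C) && adj u v = (v \in C) && (v != u)).
have [vC|//] := boolP (v \in C).
have [->|vu] := eqVneq v u; first exact: adj_irrefl.
by rewrite /= clC // eq_sym.
Qed.

(** The indicator function of [C] has Rayleigh quotient [#|C| - 1]. *)
Lemma clique_spectral_radius_ge C u0 : u0 \in C -> is_clique C ->
  #|C|%:R - 1 <= spectral_radius R G.
Proof.
move=> u0C clC; have [_ [_ _ /(_ (fun u => (u \in C)%:R))]] := @spectral_radiusP R G u0.
have sumE (f : G -> R) : dot (fun u => (u \in C)%:R) f = \sum_(u in C) f u.
  rewrite /dot [RHS]big_mkcond; apply: eq_bigr => u _.
  by case: (u \in C); rewrite ?mul1r ?mul0r.
have sum1 : \sum_(u in C) (u \in C)%:R = #|C|%:R :> R.
  by rewrite -sum1_card natr_sum; apply: eq_bigr => u ->.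
rewrite !sumE sum1.
have -> : \sum_(u in C) nbsum (fun u => (u \in C)%:R) u = #|C|%:R * (#|C|%:R - 1) :> R.
  transitivity (\sum_(u in C) (#|C|%:R - 1) : R); last by rewrite sumr_const mulr_natl.
  apply: eq_bigr => u uC; rewrite (nbsum_split C) [X in _ + X]big1 ?addr0.
    by rewrite sum_clique_nb // sum1 uC.
  by move=> v; rewrite inE => /andP[/negbTE ->].
rewrite mulrC ler_pM2r // ltr0n; apply/card_gt0P; by exists u0.
Qed.

(* The test vector consists of the first two terms, in powers of 1 / a, of the
   solution of (A y) u = a (y u) normalised on the clique. *)
Lemma clique_deg2_le C a u0 : is_clique C -> 0 < a -> spectral_radius R G <= a ->
  (u0 \in C) ->
  (\sum_(v in ~: C) deg_in C v ^ 2)%:R <= a * (a + 1) * (a + 1 - #|C|%:R).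
Proof.
move=> clC a0 la u0C; have [_ [_ _ max]] := @spectral_radiusP R G u0.
have a1 : 0 < a + 1 by rewrite addr_gt0.
have an0 : a != 0 by rewrite gt_eqF.
have a1n0 : a + 1 != 0 by rewrite gt_eqF.
pose d v : R := (deg_in C v)%:R.
pose q u := \sum_(v in ~: C | adj u v) d v.
have q0 u : 0 <= q u by apply: sumr_ge0.
pose y u := if u \in C then 1 + q u / (a * (a + 1)) else d u / a.
have yC u : u \in C -> 1 <= y u.
  by move=> uC; rewrite /y uC lerDl divr_ge0 // mulr_ge0 // ltW.
have y0 u : 0 <= y u.
  have [/yC|uC] := boolP (u \in C); first exact: le_trans.
  by rewrite /y (negbTE uC) divr_ge0 // ltW.
pose Y := \sum_(u in C) y u.
(* The residue of the eigenvalue equation is the constant [Y - (a + 1)] on [C] and nonnegative off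
   [C]; the Rayleigh bound then forces [Y <= a + 1]. *)
have AyC u : u \in C -> nbsum y u = a * y u + (Y - (a + 1)).
  move=> uC; rewrite (nbsum_split C) sum_clique_nb // -/Y.
  have -> : \sum_(v in ~: C | adj u v) y v = q u / a.
    rewrite /q mulr_suml; apply: eq_bigr => v; rewrite inE => /andP[/negbTE vC _].
    by rewrite /y vC.
  by rewrite /y uC; field; rewrite an0 a1n0.
have AyT u : u \notin C -> a * y u <= nbsum y u.
  move=> uC; rewrite (nbsum_split C) {1}/y (negbTE uC) mulrCA divff // mulr1 /d deg_in_sum.
  rewrite -[leLHS]addr0 lerD ?sumr_ge0 //; apply: ler_sum => v /andP[vC _]; exact: yC.
have : a * dot y y + Y * (Y - (a + 1)) <= a * dot y y.
  apply: le_trans (ler_wpM2r (dot_ge0 y) la); apply: le_trans (max y).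
  rewrite /dot /Y mulr_sumr mulr_suml [X in _ + X]big_mkcond -big_split /=.
  apply: ler_sum => u _; case: ifP => uC.
    by rewrite AyC // [leRHS]mulrDr [in leRHS]mulrCA lexx.
  by rewrite addr0 mulrCA ler_wpM2l // AyT // uC.
rewrite -lerBrDl subrr => YY.
have Y1 : Y <= a + 1.
  rewrite leNgt; apply/negP => lt; move: YY; apply/negP; rewrite -ltNge mulr_gt0 ?subr_gt0 //.
  exact: lt_trans lt.
(* Exchanging sums, [q] adds up over [C] to the sum of the squares [d v ^+ 2] off [C]. *)
have <- : a * (a + 1) * (Y - #|C|%:R) = (\sum_(v in ~: C) deg_in C v ^ 2)%:R.
  have -> : Y = #|C|%:R + (\sum_(u in C) q u) / (a * (a + 1)).
    rewrite mulr_suml -sum1_card natr_sum -big_split /=; apply: eq_bigr => u uC.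
    by rewrite /y uC.
  rewrite /q sum_deg_in addrAC subrr add0r mulrCA divff ?mulr1 ?mulf_neq0 //.
  by rewrite natr_sum; apply: eq_bigr => v _; rewrite natrX expr2.
by rewrite ler_wpM2l ?mulr_ge0 ?(ltW a0) ?(ltW a1) // lerD2r.
Qed.

(* Hong's bound: compare [A^2 z = a^2 z] with row sums of [A^2] at the maximum
   of [z]. *)
Lemma eigenvalue_sum_degree (z : G -> R) a u0 : (forall u, 0 < z u) ->
  is_eigenfunction a z -> (forall u, (0 < degree u)%N) ->
  a ^+ 2 + #|G|%:R <= (\sum_(u : G) degree u)%:R + 1.
Proof.
move=> z0 zE dpos; pose u := [arg max_(v > u0) z v]%O.
have zmax v : z v <= z u.
  by rewrite /u; case: Order.TotalTheory.arg_maxP => // w _; apply.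
have sumdeg (v : G) : \sum_(w | adj v w) (1 : R) = (degree v)%:R.
  by rewrite sumr_const /degree; congr (_ %:R); apply: eq_card => w; rewrite inE.
have a2 : a ^+ 2 <= (\sum_(v | adj u v) degree v)%:R.
  rewrite -(@ler_pM2r _ (z u)) // expr2 -mulrA -zE /nbsum mulr_sumr.
  rewrite natr_sum mulr_suml; apply: ler_sum => v _.
  rewrite -zE /nbsum -sumdeg mulr_suml; apply: ler_sum => w _.
  by rewrite mul1r.
(* Each vertex that is neither [u] nor adjacent to [u] contributes at least 1 to the degree sum, and
   [u] contributes its own degree. *)
have count : (\sum_(v | adj u v) degree v + #|G| <= \sum_(v : G) degree v + 1)%N.
  have sumE : (\sum_(v : G) degree v = \sum_(v | adj u v) degree v +
      (degree u + \sum_(v | ~~ adj u v && (v != u)) degree v))%N.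
    rewrite (bigID (adj u)) /=; congr (_ + _)%N.
    by rewrite (bigD1 u) ?adj_irrefl.
  have cardE : (#|G| = degree u + (1 + \sum_(v | ~~ adj u v && (v != u)) 1))%N.
    rewrite sum1_card -[LHS](cardID (adj u)) [X in (_ + X)%N](cardD1 u).
    have -> : #|[predI G & adj u]| = degree u.
      by apply: eq_card => v; rewrite !inE.
    have -> : u \in [predD G & adj u] by rewrite inE /= -topredE /= adj_irrefl.
    congr (_ + (_ + _))%N.
    by apply: eq_card => v; rewrite !inE -!topredE /= andbT andbC.
  have : (\sum_(v | ~~ adj u v && (v != u)) 1 <=
          \sum_(v | ~~ adj u v && (v != u)) degree v)%N by exact: leq_sum.
  lia.
apply: le_trans (_ : (\sum_(v | adj u v) degree v + #|G|)%:R <= _).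
  by rewrite natrD lerD2r.
by rewrite -(natrD _ _ 1) ler_nat.
Qed.

(* Substituting the eigenvalue equations on [~: T] into those on [T] twice: first
   to get [(a + 1) max_T z <= sigma], where [sigma] is the sum of [z] over
   [~: T], then to get [a (a + 1) z v <= degree v * (sigma + #|T| max_T z)]. *)
Lemma eigenvalue_deg2_ge (z : G -> R) a T (dM : nat) : (forall u, 0 < z u) ->
  is_eigenfunction a z -> (0 < #|T|)%N -> (0 < #|~: T|)%N ->
  (0 < dM)%N -> {in T, forall v, (degree v <= dM)%N} ->
  2 * dM%:R + 1 <= a -> (dM * #|T|)%:R <= a + 1 ->
  (a + 1 - #|~: T|%:R) * (a * (a + 1)) ^+ 2 <=
    (\sum_(v in T) degree v ^ 2)%:R * (a * (a + 1) + 2 * #|T|%:R * dM%:R).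
Proof.
move=> z0 zE /card_gt0P[v0 v0T] /card_gt0P[u0 u0C] dM0 dT adM atM.
pose C := ~: T; pose t : R := #|T|%:R; pose D : R := dM%:R.
pose sigma := \sum_(u in C) z u.
have z0' u : 0 <= z u by exact: ltW.
have D1 : 1 <= D by rewrite ler1n.
have t1 : 1 <= t by rewrite ler1n; apply/card_gt0P; exists v0.
have s0 : 0 < sigma.
  by rewrite /sigma (bigD1 u0) //= ltr_pwDl // sumr_ge0.
pose v1 := [arg max_(v > v0 in T) z v]%O; pose m := z v1.
have [v1T zm] : v1 \in T /\ forall v, v \in T -> z v <= m.
  by rewrite /m /v1; case: Order.TotalTheory.arg_maxP.
have m0 : 0 < m by exact: z0.
have a0 : 0 < a by rewrite /D in D1; lra.
have Dt : D * t <= a + 1 by rewrite /D /t -natrM.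
have ta : t <= a + 1 by nra.
have partT v : \sum_(w in T | adj v w) z w <= (deg_in T v)%:R * m.
  rewrite deg_in_sum mulr_suml; apply: ler_sum => w /andP[wT _].
  by rewrite mul1r zm.
have partT' v : \sum_(w in T | adj v w) z w <= t * m.
  apply: le_trans (partT v) _; rewrite ler_pM2r // ler_nat.
  by apply/subset_leq_card/fintype.subsetP => w; rewrite inE => /andP[].
have zC u : u \in C -> (a + 1) * z u <= sigma + \sum_(v in T | adj u v) z v.
  move=> uC; rewrite mulrDl mul1r -zE (nbsum_split C) finset.setCK addrAC lerD2r.
  rewrite /sigma (bigD1 u uC) /= addrC lerD2l.
  rewrite [leRHS]big_mkcond [leLHS]big_mkcond; apply: ler_sum => v _.
  change ((if (v \in C) && adj u v then z v else 0) <=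
          (if (v \in C) && (v != u) then z v else 0)).
  case: (v \in C) => //=; have [->|_] := eqVneq v u; first by rewrite adj_irrefl.
  by case: ifP => _; rewrite ?lexx ?z0'.
have zT v : v \in T -> a * (a + 1) * z v <=
    (deg_in C v)%:R * (sigma + t * m) + (deg_in T v)%:R * ((a + 1) * m).
  move=> vT; rewrite mulrAC -zE (nbsum_split C) finset.setCK mulrDl; apply: lerD.
    rewrite deg_in_sum !mulr_suml; apply: ler_sum => w /andP[wC _].
    rewrite mul1r mulrC; apply: le_trans (zC w wC) _; rewrite lerD2l; exact: partT'.
  by rewrite mulrC mulrCA ler_pM2l ?partT // ltr_wpDl // ltW.
have dE v : (deg_in C v)%:R + (deg_in T v)%:R = (degree v)%:R :> R.
  by rewrite -(deg_inE C) finset.setCK natrD.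
have dC v : v \in T -> (deg_in C v)%:R <= D /\ (deg_in T v)%:R <= D.
  move=> vT; have := dT v vT; rewrite -(deg_inE C) finset.setCK !ler_nat.
  by move=> h; split; apply: leq_trans h; rewrite ?leq_addl ?leq_addr.
(* At the maximum [v1], the terms in [m] on the right are at most [(D + 1) * (a + 1) * m]; since
   [2 * D + 1 <= a], at least [D * (a + 1) * m] is left on the other side. *)
have am : (a + 1) * m <= sigma.
  have [dC1 dT1] := dC _ v1T; have := zT _ v1T; rewrite -/m.
  set c := (deg_in C v1)%:R in dC1 *; set i := (deg_in T v1)%:R in dT1 *.
  have e1 : c * (sigma + t * m) <= D * (sigma + t * m).
    by rewrite ler_wpM2r //; nra.
  have e2 : i * ((a + 1) * m) <= D * ((a + 1) * m).
    by rewrite ler_wpM2r //; nra.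
  move=> e3; have : (a + 1) * D * m <= D * sigma.
    have e4 : D * t * m <= (a + 1) * m by rewrite ler_wpM2r // ltW.
    have e5 : (2 * D + 1) * ((a + 1) * m) <= a * ((a + 1) * m).
      by rewrite ler_wpM2r //; nra.
    by lra.
  by rewrite mulrAC mulrC ler_pM2l //; lra.
have zT' v : v \in T -> a * (a + 1) * z v <= (degree v)%:R * (sigma + t * m).
  move=> vT; apply: le_trans (zT v vT) _; rewrite -dE [leRHS]mulrDl lerD2l ler_wpM2l //.
  by apply: le_trans am _; nra.
have sum_le : (a + 1 - #|C|%:R) * sigma <= \sum_(v in T) (degree v)%:R * z v.
  rewrite mulrBl lerBlDl {1}/sigma mulr_sumr.
  apply: le_trans (_ : _ <= \sum_(u in C) (sigma + \sum_(v in T | adj u v) z v)) _.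
    exact: ler_sum.
  rewrite big_split /= sumr_const mulr_natl lerD2l sum_deg_in; apply: ler_sum => v vT.
  by rewrite ler_wpM2r // -dE lerDl.
(* The crude bound [t * m <= sigma], fed back into [zT'] at [v1], improves to
   [a * (a + 1) * m <= 2 * D * sigma]. This produces the error term [2 * t * D]. *)
have am2 : a * (a + 1) * (sigma + t * m) <= sigma * (a * (a + 1) + 2 * t * D).
  have e1 := zT' v1 v1T; rewrite -/m in e1.
  have e2 : (degree v1)%:R * (sigma + t * m) <= D * (sigma + t * m).
    by rewrite ler_wpM2r ?ler_nat ?dT //; nra.
  have e3 : t * m <= sigma by apply: le_trans am; rewrite ler_wpM2r // ltW.
  have e4 : a * (a + 1) * m <= 2 * D * sigma.
    apply: le_trans e1 _; apply: le_trans e2 _; nra.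
  have e5 : t * (a * (a + 1) * m) <= t * (2 * D * sigma) by rewrite ler_wpM2l //; lra.
  lra.
set d2 : R := (\sum_(v in T) degree v ^ 2)%:R.
have P0 : 0 < a * (a + 1) by rewrite mulr_gt0 //; lra.
have d2le : a * (a + 1) * ((a + 1 - #|C|%:R) * sigma) <= d2 * (sigma + t * m).
  apply: le_trans (ler_wpM2l (ltW P0) sum_le) _.
  rewrite /d2 natr_sum mulr_sumr mulr_suml; apply: ler_sum => v vT.
  by rewrite mulrCA natrX expr2 -mulrA ler_wpM2l // zT'.
rewrite -(ler_pM2r s0) -/C.
have -> : (a + 1 - #|C|%:R) * (a * (a + 1)) ^+ 2 * sigma =
   (a * (a + 1)) * (a * (a + 1) * ((a + 1 - #|C|%:R) * sigma)) by ring.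
apply: le_trans (ler_wpM2l (ltW P0) d2le) _.
rewrite mulrCA -[leRHS]mulrA ler_wpM2l ?ler0n // [leRHS]mulrC.
exact: am2.
Qed.

End SpectralBounds.

(** * The extremal graph *)

Section SpanningSubgraph.
Local Open Scope ring_scope.

(** Transport the Perron vector of [G] to [H]. As it is positive, any edge of [H] missing in [G]
    would push the Rayleigh quotient strictly above the spectral radius. *)
Lemma spectral_radius_spanning (R : realType) (G H : sgraph) (g : H -> G) (u0 : G) :
  connected G -> bijective g -> (forall x y, adj (g x) (g y) -> adj x y) ->
  spectral_radius R H <= spectral_radius R G -> isomorphic G H.
Proof.
move=> cG bg gadj le; have [z z0 zE] := @perron R G u0 cG.
have [f fK gK] := bg.
have [_ [_ _ /(_ (z \o g)) max]] := @spectral_radiusP R H (f u0).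
have dotE : dot (z \o g) (z \o g) = dot z z.
  by rewrite /dot (reindex g) //=; apply: onW_bij.
have zAz : dot z (nbsum z) = spectral_radius R G * dot z z.
  by rewrite /dot mulr_sumr; apply: eq_bigr => u _; rewrite zE mulrCA.
have nbE x : nbsum (z \o g) x =
    nbsum z (g x) + \sum_(y | adj x y && ~~ adj (g x) (g y)) z (g y).
  rewrite /nbsum (bigID (fun y => adj (g x) (g y))) /=; congr (_ + _).
  rewrite [RHS](reindex g) /=; last by apply: onW_bij.
  apply: eq_bigl => y; case gxy: (adj (g x) (g y)); rewrite ?andbF //.
  by rewrite gadj.
have z0' u : 0 <= z u by exact: ltW.
have sum0 : \sum_x z (g x) * \sum_(y | adj x y && ~~ adj (g x) (g y)) z (g y) <= 0.
  have : dot (z \o g) (nbsum (z \o g)) <= spectral_radius R G * dot z z.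
    apply: le_trans max _; rewrite dotE ler_wpM2r //; exact: dot_ge0.
  rewrite -zAz; have -> : dot z (nbsum z) = \sum_x z (g x) * nbsum z (g x).
    by rewrite /dot (reindex g) //=; apply: onW_bij.
  rewrite {1}/dot; under eq_bigr => x _ do rewrite nbE /= mulrDr.
  by rewrite big_split /= gerDl.
exists f; split => [|u v]; first by exists g.
rewrite -{2}[u]gK -{2}[v]gK; apply/idP/idP => [fuv|]; last exact: gadj.
apply: contraTT sum0 => nuv; rewrite -ltNge (bigD1 (f u)) //= ltr_pwDl //.
  rewrite mulr_gt0 // (bigD1 (f v)) ?fuv ?nuv //= ltr_pwDl // sumr_ge0 //.
by apply: sumr_ge0 => x _; rewrite mulr_ge0 // sumr_ge0.
Qed.

End SpanningSubgraph.

Section FGraph.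
Variables (n r k : nat).
Hypotheses (r_gt0 : 0 < r) (n_ge : 3 * r + k <= n).

(** The core of [F]: the two complete parts together. *)
Definition Fclique : {set Fgraph n r k} :=
  [set x : Fgraph n r k | if (x : _ + (_ + _)) is inr (inr _) then false else true].

Lemma Fclique_clique : is_clique Fclique.
Proof.
move=> [i|[j|l]] [i'|[j'|l']]; rewrite !inE // => _ _ xy.
all: by rewrite /= /add_edges_adj /= ?orbT //; apply/orP; left; apply: contraNN xy => /eqP ->.
Qed.

Lemma card_Fclique : #|Fclique| = n - r.+1.
Proof.
rewrite -sum1dep_card !big_sumType /= [X in (_ + (_ + X))]big_pred0_eq.
rewrite !sum1_card !card_ord; lia.
Qed.

Lemma deg_in_Fclique (i : 'I_r.+1) :
  deg_in Fclique (inr (inr i) : Fgraph n r k) = r + k + (val i == 0) * (r - 1).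
Proof.
rewrite /deg_in -sum1dep_card !big_sumType /=.
rewrite [X in (_ + (_ + X))]big_pred0; last by move=> j; rewrite inE.
rewrite addn0; congr (_ + _).
  rewrite -[RHS]card_ord -sum1_card; apply: eq_bigl => j.
  by rewrite inE.
transitivity (\sum_(j < n - (2 * r + k + 1) | (val i == 0) && (val j < r - 1)) 1).
  by apply: eq_bigl => j; rewrite inE /= /add_edges_adj /= orbF.
case: (val i == 0); last by rewrite big_pred0.
rewrite /= -(big_ord_widen _ (fun=> 1)); last by lia.
by rewrite sum1_card card_ord mul1n.
Qed.

Lemma deg2_Fclique :
  \sum_(v in ~: Fclique) deg_in Fclique v ^ 2 =
  (r + k + (r - 1)) ^ 2 + r * (r + k) ^ 2.
Proof.
rewrite !big_sumType /=.
rewrite big_pred0 => [|x]; last by rewrite !inE.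
rewrite big_pred0 => [|x]; last by rewrite !inE.
rewrite !add0n; transitivity (\sum_(i < r.+1) (r + k + (val i == 0) * (r - 1)) ^ 2).
  by apply: eq_big => [i|i _]; rewrite ?inE // deg_in_Fclique.
rewrite big_ord_recl /= mul1n; congr (_ + _).
by rewrite sum_nat_const card_ord mul0n addn0.
Qed.

End FGraph.

(** Enumerate [S], the rest [W] and [T] in the order of the parts of [F]. Only edges between [T] and
    [W] or inside [T] could be missing in [F], and the hypotheses restrict these to edges from [v0]
    to [M]. *)
Lemma Fgraph_spanning (G : sgraph) (n r k : nat) (S T : {set G}) (v0 : G) :
  #|G| = n -> [disjoint S & T] -> #|S| = r + k -> #|T| = r.+1 -> v0 \in T ->
  #|[set w | adj v0 w & w \notin S]| <= r - 1 ->
  (forall v w, v \in T -> v != v0 -> adj v w -> w \in S) ->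
  exists2 g : Fgraph n r k -> G, bijective g &
    forall x y, adj (g x) (g y) -> adj x y.
Proof.
move=> nG dST cS cT v0T cM nbT.
have TS v : v \in T -> v \notin S by move/(disjointFl dST) => ->.
pose M := [set w | adj v0 w & w \notin S]; pose W := ~: (S :|: T).
have MW : M \subset W.
  apply/fintype.subsetP => w; rewrite !inE negb_or => /andP[v0w wS]; rewrite wS /=.
  apply/negP => wT; have wv0 : w != v0.
    by apply: contraTneq v0w => ->; rewrite adj_irrefl.
  by move: (nbT w v0 wT wv0); rewrite adj_sym => /(_ v0w) /(negP (TS _ v0T)).
pose ws := enum M ++ enum (W :\: M); pose ts := v0 :: enum (T :\ v0).
have szS : size (enum S) = r + k by rewrite -cardE.
have szT : size ts = r.+1.
  by rewrite /= -cardE; have := cardsD1 v0 T; rewrite v0T cT add1n => -[->].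
have memT x : (x \in ts) = (x \in T).
  by rewrite inE mem_enum !inE; have [->|] := eqVneq x v0; rewrite ?v0T.
have memW x : (x \in ws) = (x \in W).
  rewrite mem_cat !mem_enum finset.in_setD; have [xM|//] := boolP (x \in M).
  by rewrite (fintype.subsetP MW).
have uT : uniq ts by rewrite /= enum_uniq mem_enum !inE eqxx.
have uW : uniq ws.
  rewrite cat_uniq !enum_uniq andbT /=; apply/hasPn => x.
  by rewrite !mem_enum inE => /andP[].
have szW : size ws = n - (2 * r + k + 1).
  have -> : size ws = #|W|.
    by rewrite -(card_uniqP uW); apply: eq_card => x; rewrite memW.
  have := cardsC (S :|: T); rewrite -/W cardsU cS cT nG.
  have -> : S :&: T = finset.set0 by apply/eqP; rewrite setI_eq0.
  rewrite cards0; lia.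
pose g (x : Fgraph n r k) : G := match (x : _ + (_ + _)) with
  | inl i => nth v0 (enum S) i
  | inr (inl j) => nth v0 ws j
  | inr (inr l) => nth v0 ts l end.
have gS (i : 'I_(r + k)) : nth v0 (enum S) i \in S.
  by rewrite -mem_enum mem_nth // szS.
have gW (j : 'I_(n - (2 * r + k + 1))) : nth v0 ws j \in W.
  by rewrite -memW mem_nth // szW.
have gT (l : 'I_r.+1) : nth v0 ts l \in T.
  by rewrite -memT mem_nth // szT.
have WS x : x \in W -> x \notin S by rewrite !inE negb_or => /andP[].
have WT x : x \in W -> x \notin T by rewrite !inE negb_or => /andP[].
have ginj : injective g.
  move=> [i|[j|l]] [i'|[j'|l']]; rewrite /g /= => e.
  - congr inl; apply/val_inj/eqP; rewrite -(nth_uniq v0 _ _ (enum_uniq S)) ?szS ?ltn_ord //.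
    exact/eqP.
  - by have := WS _ (gW j'); rewrite -e gS.
  - by have := TS _ (gT l'); rewrite -e gS.
  - by have := WS _ (gW j); rewrite e gS.
  - congr (inr (inl _)); apply/val_inj/eqP; rewrite -(nth_uniq v0 _ _ uW) ?szW ?ltn_ord //.
    exact/eqP.
  - by have := WT _ (gW j); rewrite e gT.
  - by have := TS _ (gT l); rewrite e gS.
  - by have := WT _ (gW j'); rewrite -e gT.
  - congr (inr (inr _)); apply/val_inj/eqP; rewrite -(nth_uniq v0 _ _ uT) ?szT ?ltn_ord //.
    exact/eqP.
exists g.
  apply: inj_card_bij ginj _; rewrite nG !card_sum !card_ord.
  have := max_card (mem W); have := cardsC (S :|: T); rewrite -/W cardsU cS cT nG.
  lia.
have TW (l : 'I_r.+1) (j : 'I_(n - (2 * r + k + 1))) :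
    adj (nth v0 ts l) (nth v0 ws j) -> (val l == 0) && (val j < r - 1).
  move=> lj; have tl : nth v0 ts l = v0.
    apply/eqP; apply: contraT => tl.
    by have := nbT _ _ (gT l) tl lj; rewrite (negbTE (WS _ (gW j))).
  apply/andP; split.
    rewrite -(nth_uniq v0 _ _ uT) ?szT ?ltn_ord // tl; exact/eqP.
  apply: leq_trans cM; rewrite -/M ltnNge; apply/negP => jM.
  have : nth v0 ws j \in W :\: M.
    rewrite nth_cat -cardE ltnNge jM /= -mem_enum mem_nth //.
    by rewrite ltn_subLR // cardE -size_cat szW.
  rewrite finset.in_setD => /andP[/negP + _]; apply.
  by rewrite inE -{1}tl lj WS.
have irr x y : adj (g x) (g y) -> x != y.
  by apply: contraTneq => ->; rewrite adj_irrefl.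
move=> x y gxy; have xy := irr x y gxy; move: x y xy gxy.
move=> [i|[j|l]] [i'|[j'|l']] xy; rewrite /g /= /add_edges_adj /= ?orbT //.
- by move=> _; apply/orP; left; apply: contraNN xy => /eqP ->.
- by move=> _; apply/orP; left; apply: contraNN xy => /eqP ->.
- by rewrite adj_sym => /TW ->.
- by move=> /TW ->.
move=> ll; have tl : nth v0 ts l = v0.
  apply/eqP; apply: contraT => tl.
  by have := nbT _ _ (gT l) tl ll; rewrite (negbTE (TS _ (gT l'))).
have tl' : nth v0 ts l' = v0.
  apply/eqP; apply: contraT => tl'; move: ll; rewrite adj_sym => ll.
  by have := nbT _ _ (gT l') tl' ll; rewrite (negbTE (TS _ (gT l))).
by rewrite tl tl' adj_irrefl in ll.
Qed.

(** * Comparison of the two graphs *)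

(* The polynomial is the gap between the two sides of [large_T_arith] for the
   worst case [j = t - 1], with [t = u + r + 1] and [n = 2 t + k - 1 + y]. *)
Lemma edge_poly_small_T_gt0 (r k u y : int) : (1 <= r -> 0 <= k -> 1 <= u -> 0 <= y ->
  4 * r ^+ 2 + 12 * r + 8 + 6 * r * k + 8 * k + 2 * k ^+ 2 <= 2 * (u + r + 1) + k - 1 + y ->
  0 < (u + r + 1) * (u + r + 1 - 4 * r - 5) + 2 * u * y - 2 * (r + 1) * (k - 1)
     + (r + 2) ^+ 2 - 2 * r + 1)%R.
Proof.
move=> r1 k0 u1 y0 h.
have uy : (0 <= u * y)%R by apply: mulr_ge0 => //; lia.
(* For large [t] the first product dominates. Otherwise [u] is bounded and the order bound makes
   [2 * u * y] large enough. *)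
have [hA|hB] := lerP (4 * r + 5 + k)%R (u + r + 1)%R.
  have : (0 <= (u + r + 1) * (u + r + 1 - 4 * r - 5 - k))%R by apply: mulr_ge0; lia.
  have : (0 <= (u + r + 1 - 4 * r - 5) * k)%R by apply: mulr_ge0; lia.
  have : (0 <= r * k)%R by apply: mulr_ge0; lia.
  have : (0 <= r ^+ 2)%R by exact: sqr_ge0.
  lra.
have : (0 <= u * (2 * (u + r + 1) + k - 1 + y -
   (4 * r ^+ 2 + 12 * r + 8 + 6 * r * k + 8 * k + 2 * k ^+ 2)))%R by apply: mulr_ge0; lia.
have : (0 <= u * (3 * r + 3 + k - u))%R by apply: mulr_ge0; lia.
have : (0 <= (u - 1) * r ^+ 2)%R by apply: mulr_ge0; [lia | exact: sqr_ge0].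
have : (0 <= (u - 1) * r)%R by apply: mulr_ge0; lia.
have : (0 <= (u - 1) * (r * k))%R by do ?apply: mulr_ge0; lia.
have : (0 <= (u - 1) * k)%R by apply: mulr_ge0; lia.
have : (0 <= (u - 1) * k ^+ 2)%R by apply: mulr_ge0; [lia | exact: sqr_ge0].
have : (0 <= r * k)%R by apply: mulr_ge0; lia.
have : (0 <= (r - 1) * r)%R by apply: mulr_ge0; lia.
have : (0 <= k ^+ 2)%R by exact: sqr_ge0.
lra.
Qed.

(* Same gap for [2 t + k > n + 1], where the worst case is [j = n - k - t]. *)
Lemma edge_poly_large_T_lt (n r k t : int) : (1 <= r -> 0 <= k ->
  4 * r ^+ 2 + 12 * r + 8 + 6 * r * k + 8 * k + 2 * k ^+ 2 <= n ->
  n + 2 <= 2 * t + k ->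
  2 * n + t + 4 * r * t + 2 * r * k - (r + 2) ^+ 2 - 1 < t ^+ 2)%R.
Proof.
move=> r1 k0 h1 h2.
have rr : (0 <= (r - 1) * r)%R by apply: mulr_ge0; lia.
have rk : (0 <= r * k)%R by apply: mulr_ge0; lia.
have kk : (0 <= k * k)%R by apply: mulr_ge0; lia.
have ht : (4 * r + 5 + k <= t)%R by lra.
have : (0 <= t * (t - 4 * r - 5 - k))%R by apply: mulr_ge0; lia.
have : (0 <= (t - 4 * r - 5) * k)%R by apply: mulr_ge0; lia.
lra.
Qed.

(** With [t = #|T|] and [d] the number of neighbours outside [S] summed over [T], the left side
    bounds the degree sum plus 1; the right side is what Hong's bound requires of it. *)
Lemma large_T_arith (n r k t j d : nat) : 0 < r ->
  2 * (2 * r + k + 2) * (r + k + 2) <= n -> r.+2 <= t -> j < t -> k + j + t <= n ->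
  d + r * j < r * t ->
  (n - t) * (n - t - 1) + 2 * (t * (k + j) + d) + 1 < (n - r - 2) ^ 2 + n.
Proof.
move=> r0 hn ht hj hs hd.
have hn' : 4 * r ^ 2 + 12 * r + 8 + 6 * r * k + 8 * k + 2 * k ^ 2 <= n by nia.
have [N nE] : exists N, n = N + r + 2 by exists (n - r - 2); nia.
have [c cE] : exists c, n = c + t by exists (n - t); lia.
have -> : n - t = c by lia.
have -> : n - r - 2 = N by lia.
have [u uE] : exists u, t = u + r + 1 by exists (t - r - 1); lia.
have u1 : 1 <= u by lia.
have cc : ((c * (c - 1))%N%:Z = c%:Z * (c%:Z - 1))%R.
  by case: (c) => [//|c']; rewrite subn1 /= PoszM intS; congr (_ * _)%R; lia.
have dE : (d%:Z <= r%:Z * t%:Z - r%:Z * j%:Z - 1)%R by lia.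
(* After [d] is bounded, the left side grows in [j] at rate [2 * (t - r) = 2 * (u + 1)]. The extreme
   [j] is [t - 1] or [n - k - t], whichever constraint binds first. *)
have [hA|hB] := leqP (2 * t + k) n.+1.
  have [y yE] : exists y, n + 1 = 2 * t + k + y by exists (n + 1 - (2 * t + k)); lia.
  have := @edge_poly_small_T_gt0 r k u y; have : (0 <= (u%:Z + 1) * (t%:Z - 1 - j%:Z))%R.
    by apply: mulr_ge0; lia.
  move=> h1 /(_ ltac:(lia) ltac:(lia) ltac:(lia) ltac:(lia) ltac:(lia)) h2.
  have nZ : (n%:Z = 2 * (u%:Z + r%:Z + 1) + k%:Z - 1 + y%:Z)%R by lia.
  have NZ : (N%:Z = 2 * (u%:Z + r%:Z + 1) + k%:Z - 1 + y%:Z - r%:Z - 2)%R by lia.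
  have cZ : (c%:Z = (u%:Z + r%:Z + 1) + k%:Z - 1 + y%:Z)%R by lia.
  have tZ : (t%:Z = u%:Z + r%:Z + 1)%R by lia.
  rewrite -mulnn -ltz_nat !PoszD cc !PoszM !PoszD NZ nZ cZ; rewrite tZ in h1 dE *.
  lra.
have := @edge_poly_large_T_lt n r k t ltac:(lia) ltac:(lia) ltac:(lia) ltac:(lia).
have : (0 <= (u%:Z + 1) * (n%:Z - k%:Z - t%:Z - j%:Z))%R by apply: mulr_ge0; lia.
have NZ : (N%:Z = n%:Z - r%:Z - 2)%R by lia.
have cZ : (c%:Z = n%:Z - t%:Z)%R by lia.
have tZ : (u%:Z = t%:Z - r%:Z - 1)%R by lia.
move=> h1 h2.
rewrite -mulnn -ltz_nat !PoszD cc !PoszM !PoszD NZ cZ; rewrite tZ in h1; lra.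
Qed.

(** A gap [g] between sums of squares outweighs the error term of [eigenvalue_deg2_ge] for
    [#|T| = r + 1] and degrees at most [2 * r + k - 1]. In terms of [p] and [q] below,
    [D <= (r + 1) * p ^ 2] and [3 * (p * q) ^ 2 <= (n - r - 2) ^ 2]; what remains is
    [r + 1 < r + 2 <= 3 * g] and [2 * (r + 1) <= q]. *)
Lemma deg2_gap_arith (n r k g D : nat) : 0 < r ->
  2 * (2 * r + k + 2) * (r + k + 2) <= n -> r + 2 <= 3 * g ->
  D <= (r + k + (r - 1)) ^ 2 + r * (r + k) ^ 2 ->
  2 * (r + 1) * (2 * r + k - 1) * D < g * (n - r - 2) ^ 2.
Proof.
move=> r0 hn hg hD; pose p := r + k + 2; pose q := 2 * r + k + 2.
have hpq : 2 * (p * q) <= n by rewrite [p * q]mulnC mulnA.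
have hN : p * (2 * q - 1) <= n - r - 2.
  have pr : r + 2 <= p by rewrite /p; lia.
  rewrite mulnBr muln1 mulnCA; lia.
have hq : 3 * q ^ 2 <= (2 * q - 1) ^ 2.
  clear hn hD hpq hN.
  (* The inequality needs [q >= 4], which is [r >= 1]. *)
  have [q' ->] : exists q', q = q' + 4 by exists (q - 4); rewrite /q; lia.
  have -> : 2 * (q' + 4) - 1 = 2 * q' + 7 by lia.
  by rewrite -!mulnn; lia.
have hp : D <= (r + 1) * p ^ 2.
  apply: leq_trans hD _; pose x := r + k.
  have -> : p = x + 2 by [].
  have -> : r + k + (r - 1) = x + (r - 1) by [].
  have [r' rE] : exists r', r = r' + 1 by exists (r - 1); lia.
  have r'x : r' * r' <= r' * x by rewrite leq_mul2l /x; lia.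
  have -> : r - 1 = r' by lia.
  rewrite -/x rE -!mulnn; lia.
have N2 : 3 * (p * q) ^ 2 <= (n - r - 2) ^ 2.
  apply: leq_trans (_ : (p * (2 * q - 1)) ^ 2 <= _); last by rewrite leq_exp2r.
  by rewrite !expnMn mulnCA leq_mul2l hq orbT.
apply: leq_trans (_ : g * (3 * (p * q) ^ 2) <= _); last by rewrite leq_mul2l N2 orbT.
have p0 : 0 < p ^ 2 * q by rewrite muln_gt0 expn_gt0 /p /q !addn2.
have h1 : 2 * (r + 1) * (2 * r + k - 1) * D <= 2 * (r + 1) * q * ((r + 1) * p ^ 2).
  by apply: leq_mul hp; rewrite leq_mul2l /q; apply/orP; right; clear; lia.
have h2 : (r + 2) * (2 * (r + 1)) * (p ^ 2 * q) <= g * (3 * (p * q) ^ 2).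
  have -> : g * (3 * (p * q) ^ 2) = (3 * g) * q * (p ^ 2 * q) by ring.
  rewrite leq_mul2r leq_mul ?orbT // /q; clear; lia.
apply: leq_trans h2; apply: leq_ltn_trans h1 _.
have -> : 2 * (r + 1) * q * ((r + 1) * p ^ 2) = (r + 1) * (2 * (r + 1)) * (p ^ 2 * q) by ring.
by rewrite ltn_pmul2r // ltn_pmul2r ?muln_gt0 ?addn1 // addn2.
Qed.

(** * Degree sums and excess degrees *)

Section DegreeCounts.
Context {G : sgraph}.
Implicit Types (S T : {set G}) (e : G -> nat).

Lemma min_degree_le (v : G) : min_degree G <= degree v.
Proof.
rewrite /min_degree; elim: (index_enum G) (mem_index_enum v) => // u s IHs.
rewrite inE big_cons => /predU1P[<-|/IHs]; first exact: geq_minl.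
by apply: leq_trans; exact: geq_minr.
Qed.

Lemma degree_le_outside S v : degree v <= #|S| + #|[set w | adj v w & w \notin S]|.
Proof.
rewrite -(deg_inE S); apply: leq_add.
  by apply/subset_leq_card/fintype.subsetP => w; rewrite inE => /andP[].
by apply: eq_leq; apply: eq_card => w; rewrite !inE andbC.
Qed.

(** Edges between [T] and its complement are counted from their ends in [T] both times, whence the
    factor 2. *)
Lemma sum_degree_le T :
  \sum_(v : G) degree v <= #|~: T| * (#|~: T| - 1) + 2 * \sum_(v in T) degree v.
Proof.
rewrite (bigID (mem T)) /= mul2n -addnn addnCA leq_add2l.
have -> : \sum_(v | v \notin T) degree v =
    \sum_(v in ~: T) deg_in (~: T) v + \sum_(v in ~: T) deg_in T v.
  rewrite -big_split /=; apply: eq_big => v; first by rewrite inE.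
  by move=> _; rewrite -(deg_inE (~: T)) finset.setCK.
apply: leq_add.
  rewrite -sum_nat_const; apply: leq_sum => v vT.
  have -> : #|~: T| - 1 = #|(~: T) :\ v|.
    by have := cardsD1 v (~: T); rewrite vT => ->; rewrite addKn.
  apply/subset_leq_card/fintype.subsetP => w; rewrite !inE => /andP[-> vw].
  by rewrite andbT; apply: contraTneq vw => ->; rewrite adj_irrefl.
have dE C (v : G) : deg_in C v = \sum_(w in C | adj v w) 1.
  by rewrite /deg_in -sum1_card; apply: eq_bigl => w; rewrite inE.
under eq_bigr => v _ do rewrite dE.
rewrite (exchange_big_dep (mem T)) /=; last by move=> u v _ /andP[].
apply: leq_sum => v vT; rewrite -(deg_inE (~: T)) dE.
apply: leq_trans (leq_addr _ _); apply: eq_leq; apply: eq_bigl => u.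
by rewrite vT /= adj_sym.
Qed.

Lemma sum_degree2_le T e s : {in T, forall v, degree v <= s + e v} ->
  \sum_(v in T) degree v ^ 2 <=
  #|T| * s ^ 2 + 2 * s * \sum_(v in T) e v + \sum_(v in T) e v ^ 2.
Proof.
move=> dT; rewrite -sum_nat_const big_distrr -!big_split /=; apply: leq_sum => v vT.
apply: leq_trans (_ : (s + e v) ^ 2 <= _); first by rewrite leq_exp2r // dT.
by rewrite sqrnD; lia.
Qed.

Lemma sum_sqr_le T e v : v \in T ->
  \sum_(w in T) e w ^ 2 <= e v ^ 2 + (\sum_(w in T) e w - e v) ^ 2.
Proof.
move=> vT; rewrite (bigD1 v) //= leq_add2l [in leqRHS](bigD1 v) //= addKn.
rewrite -mulnn big_distrl /=; apply: leq_sum => w wT.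
by rewrite -mulnn leq_mul2l (bigD1 w) //= leq_addr orbT.
Qed.

End DegreeCounts.

(** The extreme split of [r - 1] is [1] and [r - 2], which loses exactly [2 * (r - 2)]. *)
Lemma two_excess_gap (r x y : nat) : 0 < x -> 0 < y -> x + y <= r - 1 ->
  x ^ 2 + y ^ 2 + 2 * (r - 2) <= (r - 1) ^ 2.
Proof.
move=> x0 y0 xy; have [x' xE] : exists x', x = x'.+1 by exists x.-1; lia.
have [y' yE] : exists y', y = y'.+1 by exists y.-1; lia.
have [z rE] : exists z, r = x' + y' + z + 3 by exists (r - (x' + y' + 3)); lia.
have -> : r - 2 = x' + y' + z + 1 by lia.
have -> : r - 1 = x' + y' + z + 2 by lia.
rewrite xE yE -!mulnn; lia.
Qed.

(** * Contradictions from the spectral bounds *)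

Section Contradictions.
Local Open Scope ring_scope.

(** Hong's bound asks for a degree sum that counting degrees over [T] and its complement does not
    allow. *)
Lemma large_T_contradiction (R : realType) (G : sgraph) (r k n j : nat)
    (T S : {set G}) (z : G -> R) (a : R) (u0 : G) :
  (0 < r)%N -> #|G| = n -> (2 * (2 * r + k + 2) * (r + k + 2) <= n)%N ->
  [disjoint S & T] -> #|S| = (k + j)%N -> (r.+2 <= #|T|)%N -> (j < #|T|)%N ->
  (\sum_(v in T) #|[set w | adj v w & w \notin S]| + r * j < r * #|T|)%N ->
  (forall v : G, 0 < degree v)%N -> (forall u, 0 < z u) -> is_eigenfunction a z ->
  (n - r - 2)%:R <= a -> False.
Proof.
move=> r0 nG hn dST cS ht hj hd dpos z0 zE aN.
have := @eigenvalue_sum_degree R G z a u0 z0 zE dpos; rewrite nG => hong.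
have hs : (k + j + #|T| <= n)%N.
  rewrite -cS -nG; have := cardsU S T.
  have -> : S :&: T = finset.set0 by apply/eqP; rewrite setI_eq0.
  by rewrite cards0 subn0 => <-; exact: max_card.
have := large_T_arith _ _ _ _ _ _ r0 hn ht hj hs hd; apply/negP; rewrite -leqNgt.
have : ((n - r - 2) ^ 2 + n <= \sum_(u : G) degree u + 1)%N.
  rewrite -(ler_nat R) !natrD natrX; apply: le_trans hong; rewrite lerD2r.
  by rewrite ler_pXn2r ?nnegrE ?(le_trans (ler0n _ _) aN).
move=> h; apply: leq_trans h _; rewrite leq_add2r.
apply: leq_trans (sum_degree_le T) _.
have -> : #|~: T| = (n - #|T|)%N by rewrite -nG -(cardsC T) addKn.
rewrite leq_add2l leq_mul2l -cS -sum_nat_const -big_split /=.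
by apply: leq_sum => v _; exact: degree_le_outside.
Qed.

(** Both estimates bound [a + 1 - (n - r - 1)], from below by the squares in [F] and from above by
    those in [G]. Together they bound [g * (a * (a + 1))] by the error term, although
    [a * (a + 1) >= (n - r - 2) ^ 2]. *)
Lemma deg2_gap_contradiction (R : realType) (G : sgraph) (r k n g : nat)
    (T : {set G}) (z : G -> R) (a : R) :
  (0 < r)%N -> #|G| = n -> (2 * (2 * r + k + 2) * (r + k + 2) <= n)%N ->
  #|T| = r.+1 -> {in T, forall v, degree v <= 2 * r + k - 1}%N ->
  (forall u, 0 < z u) -> is_eigenfunction a z ->
  (n - r - 2)%:R <= a ->
  ((r + k + (r - 1)) ^ 2 + r * (r + k) ^ 2)%:R <= a * (a + 1) * (a + 1 - (n - r.+1)%:R) ->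
  (\sum_(v in T) degree v ^ 2 + g <= (r + k + (r - 1)) ^ 2 + r * (r + k) ^ 2)%N ->
  (r + 2 <= 3 * g)%N -> False.
Proof.
move=> r0 nG hn cT dT z0 zE aN lower gap hg.
set D2 := (_ + r * _)%N in lower gap.
have cC : #|~: T| = (n - r.+1)%N by rewrite -nG -(cardsC T) cT addKn.
have big : (r + 2 + (2 * r + k - 1) * r.+1 + 2 * (2 * r + k - 1) + 2 <= n)%N.
  apply: leq_trans hn; have [x ->] : exists x, r = x.+1 by exists r.-1; lia.
  have -> : (2 * x.+1 + k - 1 = 2 * x + k + 1)%N by lia.
  clear; nia.
have n_gt : (r + 2 < n)%N by move: hn r0; clear; nia.
have dM0 : (0 < 2 * r + k - 1)%N by lia.
have a1 : 2 * (2 * r + k - 1)%:R + 1 <= a.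
  apply: le_trans aN; rewrite -natrM -(natrD _ _ 1) ler_nat; lia.
have a2 : ((2 * r + k - 1) * #|T|)%:R <= a + 1.
  apply: (@le_trans _ _ (n - r - 2)%:R); last by rewrite ler_wpDr.
  rewrite cT ler_nat; lia.
have T0 : (0 < #|T|)%N by rewrite cT.
have C0 : (0 < #|~: T|)%N by rewrite cC; lia.
have := @eigenvalue_deg2_ge R G z a T _ z0 zE T0 C0 dM0 dT a1 a2.
rewrite cC cT; set P := a * (a + 1) in lower *; set x := a + 1 - _ in lower *.
set S2 := (\sum_(v in T) _)%N in gap * => upper.
have a0 : 0 <= a by apply: le_trans aN.
have PN : (n - r - 2)%:R ^+ 2 <= P.
  rewrite /P expr2; apply: ler_pM => //; apply: (le_trans aN); lra.
have N0 : 0 < (n - r - 2)%:R :> R by rewrite ltr0n -subnDA subn_gt0.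
have P0 : 0 < P by apply: lt_le_trans PN; rewrite exprn_gt0.
have h1 : D2%:R * P <= S2%:R * (P + 2 * r.+1%:R * (2 * r + k - 1)%:R).
  apply: le_trans upper; rewrite expr2 mulrA ler_pM2r // [x * P]mulrC //.
have h2 : (S2%:R + g%:R) * P <= D2%:R * P.
  by rewrite ler_pM2r // -natrD ler_nat.
have h3 : g%:R * P <= S2%:R * (2 * r.+1%:R * (2 * r + k - 1)%:R) by lra.
have S2D : (S2 <= D2)%N by apply: leq_trans gap; exact: leq_addr.
have := deg2_gap_arith _ _ _ _ _ r0 hn hg S2D; apply/negP; rewrite -leqNgt.
rewrite -(ler_nat R) natrM natrX.
apply: (@le_trans _ _ (g%:R * P)); first by rewrite ler_wpM2l.
apply: le_trans h3 _; by rewrite -!natrM ler_nat addn1 mulnC.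
Qed.

End Contradictions.

Section FBound.
Local Open Scope ring_scope.

Lemma Fgraph_bounds (R : realType) (r k n : nat) (a : R) : (0 < r)%N ->
  (2 * (2 * r + k + 2) * (r + k + 2) <= n)%N -> spectral_radius R (Fgraph n r k) <= a ->
  (n - r - 2)%:R <= a /\
  ((r + k + (r - 1)) ^ 2 + r * (r + k) ^ 2)%:R <= a * (a + 1) * (a + 1 - (n - r.+1)%:R).
Proof.
move=> r0 hn la; have n_ge : (3 * r + k <= n)%N by nia.
have n_gt : (r + 2 < n)%N by nia.
have rk : (0 < r + k)%N by lia.
pose u0 : Fgraph n r k := inl (Ordinal rk).
have u0C : u0 \in Fclique n r k by rewrite inE.
have aN : (n - r - 2)%:R <= a.
  apply: le_trans la; have := @clique_spectral_radius_ge R _ _ u0 u0C (Fclique_clique n r k).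
  rewrite card_Fclique //; apply: le_trans; rewrite lerBrDr -(natrD _ _ 1) ler_nat; lia.
split=> //; rewrite -(deg2_Fclique n r k) // -(card_Fclique n r k) //.
apply: (@clique_deg2_le R _ _ a u0 (Fclique_clique n r k) _ la u0C).
apply: lt_le_trans aN; rewrite ltr0n; lia.
Qed.

End FBound.

(** Here [e] bounds the excess over the base degree [s]. Two vertices with positive excess cost
    [2 * (r - 2)] in the sum of squares, by [two_excess_gap]; otherwise one vertex carries it
    all. *)
Lemma excess_structure (G : sgraph) (r s : nat) (T : {set G}) (e : G -> nat) :
  0 < r -> #|T| = r.+1 -> {in T, forall v, degree v <= s + e v} ->
  \sum_(v in T) e v <= r - 1 ->
  (\sum_(v in T) degree v ^ 2 + 2 * (r - 2) <= (s + (r - 1)) ^ 2 + r * s ^ 2) /\ 2 < r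
  \/ exists2 v0, v0 \in T & forall v, v \in T -> v != v0 -> e v = 0.
Proof.
move=> r0 cT dT eT.
have [/exists_inP[v0 v0T ev0]|] := boolP [exists v0 in T, 0 < e v0]; last first.
  rewrite negb_exists_in => /forall_inP e0.
  have /card_gt0P[v0 v0T] : 0 < #|T| by rewrite cT.
  by right; exists v0 => // v vT _; apply/eqP; rewrite -leqn0 leqNgt e0.
have [/exists_inP[v1 v1T /andP[v10 ev1]]|] :=
  boolP [exists v1 in T, (v1 != v0) && (0 < e v1)]; last first.
  rewrite negb_exists_in => /forall_inP e0; right; exists v0 => // v vT vv0.
  by apply/eqP; rewrite -leqn0 leqNgt; have := e0 v vT; rewrite vv0.
left; have := sum_degree2_le T e s dT; rewrite cT.
have := sum_sqr_le T e v0 v0T; set E := \sum_(w in T) e w in eT *.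
have E01 : e v0 + e v1 <= E.
  by rewrite /E (bigD1 v0) //= leq_add2l (bigD1 v1) ?v1T //= leq_addr.
have y0 : 0 < E - e v0 by lia.
have xyE : e v0 + (E - e v0) = E by lia.
have := two_excess_gap r _ _ ev0 y0; rewrite xyE => /(_ eT) h1 h2 h3.
split; last by lia.
have h4 : 2 * s * E <= 2 * s * (r - 1) by rewrite leq_mul2l eT orbT.
rewrite sqrnD; move: h1 h2 h3 h4; rewrite mulSn; lia.
Qed.

Theorem theorem1p8 (R : realType) (r k n : nat) (G : sgraph) :
  1 <= r ->
  connected G ->
  #|G| = n ->
  2 * (2 * r + k + 2) * (r + k + 2) <= n ->
  r + k <= min_degree G ->
  (spectral_radius R (Fgraph n r k) <= spectral_radius R G)%R ->
  fractional_critical R r k G \/ isomorphic G (Fgraph n r k).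
Proof.
move=> r0 cG nG hn hdeg la; have [|nfc] := pselect (fractional_critical R r k G).
  by left.
right; have [S [T [j [dST cS hd]]]] := critical_obstruction _ _ _ _ nfc.
have deg_ge (v : G) : r + k <= degree v by apply: leq_trans hdeg (min_degree_le v).
pose m (v : G) := #|[set w | adj v w & w \notin S]|.
have deg_le (v : G) : degree v <= k + j + m v by rewrite -cS; exact: degree_le_outside.
rewrite -/(\sum_(v in T) m v) in hd.
have [/card_gt0P[u0 _]] : 0 < #|G| by rewrite nG; nia.
have [z z0 zE] := @perron R G u0 cG.
have [aN lower] := Fgraph_bounds R r k n _ r0 hn la.
have sum_ge : #|T| * (r + k) <= \sum_(v in T) degree v.
  by rewrite -sum_nat_const; apply: leq_sum.
have sum_le : \sum_(v in T) degree v <= #|T| * (k + j) + \sum_(v in T) m v.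
  by rewrite -sum_nat_const -big_split; apply: leq_sum.
have jT : j < #|T| by rewrite -(ltn_pmul2l r0); apply: leq_ltn_trans hd; exact: leq_addl.
(* The minimum degree gives [r * #|T| <= j * #|T| + \sum_(v in T) m v]; adding the obstruction
   inequality yields both [0 < j] and [r < #|T|]. *)
have tj : r * j < j * #|T|.
  move: sum_ge sum_le; rewrite !mulnDr; lia.
have rT : r < #|T| by move: tj; rewrite mulnC ltn_mul2l => /andP[].
have j0 : 0 < j by move: tj; rewrite mulnC ltn_mul2l => /andP[].
have dpos (v : G) : 0 < degree v by apply: leq_trans (deg_ge v); lia.
move: rT; rewrite leq_eqVlt => /predU1P[cT|rT]; last first.
  by case: (large_T_contradiction _ _ _ _ _ _ _ _ _ _ u0 r0 nG hn dST cS rT jT hd dpos z0 zE aN).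
have {}cT := esym cT.
have dM e : {in T, forall v, degree v <= r + k + e v} -> \sum_(v in T) e v <= r - 1 ->
    {in T, forall v, degree v <= 2 * r + k - 1}.
  move=> de se v vT; have := de v vT.
  have : e v <= \sum_(w in T) e w by rewrite (bigD1 v) //= leq_addr.
  lia.
have gap g e (de : {in T, forall v, degree v <= r + k + e v})
    (se : \sum_(v in T) e v <= r - 1) :=
  deg2_gap_contradiction R G r k n g T z _ r0 nG hn cT (dM e de se) z0 zE aN lower.
rewrite cT in hd sum_le sum_ge jT.
move: jT; rewrite ltnS leq_eqVlt => /predU1P[jr|jr]; last first.
  (* If [j < r], the excess is taken over the minimum degree. Its total is at most [j - 1 <= r - 2],
     one less than in [F]. *)
  pose e (v : G) := degree v - (r + k).
  have de : {in T, forall v, degree v <= r + k + e v}.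
    by move=> v _; rewrite /e subnKC.
  have eE : \sum_(v in T) degree v = r.+1 * (r + k) + \sum_(v in T) e v.
    rewrite -cT -sum_nat_const -big_split /=; apply: eq_bigr => v _.
    by rewrite /e subnKC.
  have eT : \sum_(v in T) e v <= r - 2.
    move: hd sum_le; rewrite eE !mulnDr !mulSn; lia.
  have eT' : \sum_(v in T) e v <= r - 1 by lia.
  (* The cross term [2 * s * E] loses [2 * (r + k)] and the square of the excess loses
     [(r - 1) ^ 2 - (r - 2) ^ 2 = 2 * r - 3]. *)
  exfalso; apply: (gap (2 * (r + k) + (2 * r - 3)) e de eT' _); last by lia.
  have sq : \sum_(v in T) e v ^ 2 <= (r - 2) ^ 2.
    apply: leq_trans (_ : (\sum_(v in T) e v) ^ 2 <= _); last by rewrite leq_exp2r.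
    rewrite -mulnn big_distrl /=; apply: leq_sum => w wT.
    by rewrite -mulnn leq_mul2l (bigD1 w) //= leq_addr orbT.
  have := sum_degree2_le T e _ de; rewrite cT.
  have : 2 * (r + k) * \sum_(v in T) e v <= 2 * (r + k) * (r - 2).
    by rewrite leq_mul2l eT orbT.
  have [x rE] : exists x, r = x + 2 by exists (r - 2); lia.
  move: sq; rewrite rE; have -> : x + 2 - 2 = x by lia.
  have -> : x + 2 - 1 = x + 1 by lia.
  have -> : 2 * (x + 2) - 3 = 2 * x + 1 by lia.
  rewrite !sqrnD mulSn; lia.
(* For [j = r], [S] has the size [r + k] of the join part of [F], and [m] itself serves as the
   excess. *)
rewrite jr in cS hd deg_le.
have de : {in T, forall v, degree v <= r + k + m v}.
  by move=> v _; rewrite [r + k]addnC.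
have mT : \sum_(v in T) m v <= r - 1 by move: hd; rewrite mulnS; lia.
have [[g r2]|[v0 v0T m0]] := excess_structure G r (r + k) T m r0 cT de mT.
  (* The gap [2 * (r - 2)] suffices because [r >= 3] when two vertices have positive excess. *)
  by exfalso; apply: (gap (2 * (r - 2)) m de mT g); lia.
have mv0 : m v0 <= r - 1.
  by apply: leq_trans mT; rewrite (bigD1 v0) //= leq_addr.
have nbT v w : v \in T -> v != v0 -> adj v w -> w \in S.
  move=> vT vv0 vw; apply: contraT => wS.
  by have /eqP := m0 v vT vv0; rewrite cards_eq0 => /eqP/setP/(_ w); rewrite !inE vw wS.
rewrite addnC in cS.
have [gg gb gadj] := Fgraph_spanning G n r k S T v0 nG dST cS cT v0T mv0 nbT.
exact: (@spectral_radius_spanning R G _ gg u0 cG gb gadj la).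
Qed.
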